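(* Let $m,n\ge 1$ be integers, let $A_1,\dots,A_m$ be arbitrary $n\times n$ complex matrices and let $Q$ be an $n\times n$ Hermitian positive definite matrix. Then there exists a unique Hermitian positive definite matrix $X$ satisfying $$X-\sum_{i=1}^{m}A_i^*X^{-1}A_i=Q,$$ and for every Hermitian positive definite initial matrix $X_0$ the iteration $$X_k=Q+\sum_{i=1}^{m}A_i^*X_{k-1}^{-1}A_i,\qquad k=1,2,\dots$$ converges to $X$.
   Context: $A^*$ denotes the conjugate transpose of $A$. *)

(* Defs.v *)
From HB Require Import structures.
From mathcomp Require Import all_boot all_order all_algebra.
From mathcomp Require Import complex.
From mathcomp Require Import reals topology normedtype.

Set Implicit Arguments.
Unset Strict Implicit.
Unset Printing Implicit Defensive.

Import Order.TTheory GRing.Theory Num.Theory.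
Import numFieldNormedType.Exports.
Local Open Scope ring_scope.
Local Open Scope sesquilinear_scope.

(* MathComp-Analysis attaches a topology to every numFieldType, but does not
   find it on the bare type R[i]; the type annotation makes it available, and
   with it the entrywise topology on matrices. *)
Definition complexes (R : realType) : numClosedFieldType := R[i]%C.

(* In a numClosedFieldType, 0 < z means that z is real and positive. *)
Definition hermitian_posdef (C : numClosedFieldType) (n : nat) (A : 'M[C]_n) :
    Prop :=
  A \is hermsymmx /\
  forall x : 'cV[C]_n, x != 0 -> 0 < (x^t* *m A *m x) 0 0.

(* Main.v *)
(** Order the Hermitian matrices by [X <= Y] iff [Y - X] is positive
    semidefinite, and put [S(X) = sum_i A_i^* X^-1 A_i], [F(X) = Q + S(X)].
    Inversion reverses the order on positive definite matrices, so
    [Y <= (1 + d) X] gives [S(X) <= (1 + d) S(Y)].  If moreover [S(Q) <= c Q],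
    then [S(Y) <= c Q] for all [Y >= Q], and the summand [Q], which is not
    scaled, turns the factor [1 + d] into [1 + d c / (1 + c)].  Hence [F]
    contracts the multiplicative distance between two matrices [>= Q] by the
    factor [c / (1 + c) < 1].  Since [F] maps every positive definite matrix
    above [Q], the orbit of [Q] is Cauchy and its limit is a fixed point that
    attracts every orbit. *)
Require Import Defs.
From HB Require Import structures.
From mathcomp Require Import all_boot all_order all_algebra.
From mathcomp Require Import complex ring.
From mathcomp Require Import boolp classical_sets reals topology normedtype sequences.

Set Implicit Arguments.
Unset Strict Implicit.
Unset Printing Implicit Defensive.

Import Order.TTheory GRing.Theory Num.Theory.
Import numFieldNormedType.Exports.
Local Open Scope classical_set_scope.
Local Open Scope ring_scope.
Local Open Scope sesquilinear_scope.

(** * Quadratic forms, the Loewner order and positive definiteness *)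

Definition sform (C : numClosedFieldType) n (A : 'M[C]_n) (x y : 'cV[C]_n) : C :=
  (x^t* *m A *m y) 0 0.

(** In [C], [a <= b] includes that [b - a] is real, so this makes [B - A] Hermitian positive
    semidefinite. *)
Definition loewner_le (C : numClosedFieldType) n (A B : 'M[C]_n) : Prop :=
  forall x, sform A x x <= sform B x x.

(** Positivity of the form forces Hermitian symmetry over [C], see [hermitian_posdefE]. *)
Definition posdef (C : numClosedFieldType) n (A : 'M[C]_n) : Prop :=
  forall x, x != 0 -> 0 < sform A x x.

Section SesquilinearForm.
Variables (C : numClosedFieldType) (n : nat).
Implicit Types (A B : 'M[C]_n) (x y z : 'cV[C]_n) (a : C).

Lemma sformDm A B x y : sform (A + B) x y = sform A x y + sform B x y.
Proof. by rewrite /sform mulmxDr mulmxDl mxE. Qed.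

Lemma sformNm A x y : sform (- A) x y = - sform A x y.
Proof. by rewrite /sform mulmxN mulNmx mxE. Qed.

Lemma sformZm a A x y : sform (a *: A) x y = a * sform A x y.
Proof. by rewrite /sform -scalemxAr -scalemxAl mxE. Qed.

Lemma sform_summ (I : finType) (F : I -> 'M[C]_n) x y :
  sform (\sum_i F i) x y = \sum_i sform (F i) x y.
Proof. by rewrite /sform mulmx_sumr mulmx_suml summxE. Qed.

Lemma sformDl A x y z : sform A (x + y) z = sform A x z + sform A y z.
Proof. by rewrite /sform linearD /= map_mxD !mulmxDl mxE. Qed.

Lemma sformDr A x y z : sform A x (y + z) = sform A x y + sform A x z.
Proof. by rewrite /sform mulmxDr mxE. Qed.

Lemma sformZl a A x y : sform A (a *: x) y = a^* * sform A x y.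
Proof. by rewrite /sform linearZ /= map_mxZ -!scalemxAl mxE. Qed.

Lemma sformZr a A x y : sform A x (a *: y) = a * sform A x y.
Proof. by rewrite /sform -scalemxAr mxE. Qed.

Lemma sformNl A x y : sform A (- x) y = - sform A x y.
Proof. by rewrite -scaleN1r sformZl rmorphN1 mulN1r. Qed.

Lemma sformNr A x y : sform A x (- y) = - sform A x y.
Proof. by rewrite -scaleN1r sformZr mulN1r. Qed.

Lemma sform0 A : sform A 0 0 = 0.
Proof. by rewrite /sform mulmx0 mxE. Qed.

Lemma sform_congr m (A : 'M[C]_m) (B : 'M[C]_(m, n)) x y :
  sform (B^t* *m A *m B) x y = sform A (B *m x) (B *m y).
Proof. by rewrite /sform trmx_mul map_mxM !mulmxA. Qed.

Lemma sform_delta A i j : sform A (delta_mx i 0) (delta_mx j 0) = A i j.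
Proof.
rewrite /sform trmx_delta map_delta_mx -rowE -colE.
by rewrite !mxE.
Qed.

Lemma sformE A x y : sform A x y = \sum_i \sum_j (x i 0)^* * A i j * y j 0.
Proof.
rewrite /sform mxE exchange_big; apply: eq_bigr => j _.
rewrite mxE big_distrl; apply: eq_bigr => i _ /=.
by rewrite !mxE.
Qed.

(** Polarization for a form that is conjugate linear on the left: the terms with ['i] cancel
    [sform A y x]. *)
Lemma sform_polar A x y : sform A x y *+ 4 =
  sform A (x + y) (x + y) - sform A (x - y) (x - y)
  - 'i * sform A (x + 'i *: y) (x + 'i *: y)
  + 'i * sform A (x - 'i *: y) (x - 'i *: y).
Proof.
rewrite !(sformDl, sformDr, sformNl, sformNr, sformZl, sformZr) conjCi.
ring: (@sqrCi C).
Qed.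

(** Reality at [x + y] and at [x + 'i *: y] gives two linear equations for the conjugates of
    [sform A x y] and [sform A y x]; their sum is twice the claim. *)
Lemma sform_real_conj A x y :
  (forall z, sform A z z \is Num.real) -> (sform A x y)^* = sform A y x.
Proof.
move=> rA.
have /CrealP e1 := rA (x + y).
have /CrealP e2 := rA (x + 'i *: y).
move: e1 e2; rewrite !(sformDl, sformDr, sformZl, sformZr) conjCi.
have /CrealP ex := rA x; have /CrealP ey := rA y.
rewrite !(rmorphD, rmorphM, rmorphN) /= conjCi ex ey => e1 e2.
set s := sform A x y in e1 e2 *; set t := sform A y x in e1 e2 *.
have {}e1 : s^* + t^* - (s + t) = 0.
  by move/eqP: e1; rewrite -subr_eq0 => /eqP <-; ring.
have {}e2 : s^* - t^* - (t - s) = 0.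
  rewrite -(mulr0 'i); move/eqP: e2; rewrite -subr_eq0 => /eqP <-.
  ring: (@sqrCi C).
apply: (@mulIf _ 2%:R); first by rewrite pnatr_eq0.
apply: subr0_eq; rewrite -[RHS]addr0 -{1}e1 -e2; ring.
Qed.

Lemma sform_real_herm A : (forall z, sform A z z \is Num.real) -> A^t* = A.
Proof.
move=> rA; apply/matrixP => i j; rewrite !mxE -!(sform_delta A).
exact: sform_real_conj.
Qed.

Lemma hermsymmxE A : (A \is hermsymmx) = (A^t* == A).
Proof.
by apply/is_hermitianmxP/eqP; rewrite expr0 scale1r.
Qed.

Lemma posdef_real A : posdef A -> forall z, sform A z z \is Num.real.
Proof.
move=> pA z; have [->|/pA/gtr0_real//] := eqVneq z 0.
by rewrite sform0 real0.
Qed.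

Lemma posdef_ge0 A x : posdef A -> 0 <= sform A x x.
Proof.
move=> pA; have [->|/pA/ltW//] := eqVneq x 0.
by rewrite sform0.
Qed.

Lemma posdef_herm A : posdef A -> A^t* = A.
Proof. by move/posdef_real/sform_real_herm. Qed.

Lemma hermitian_posdefE A : hermitian_posdef A <-> posdef A.
Proof.
split=> [[_ //]|pA]; split=> //.
by rewrite hermsymmxE posdef_herm.
Qed.

(** A nonzero row of the left kernel would yield a nonzero vector at which the form vanishes. *)
Lemma posdef_unit A : posdef A -> A \in unitmx.
Proof.
move=> pA; rewrite -row_free_unit -kermx_eq0 -nz_row_eq0.
have [e0|/pA] := eqVneq ((nz_row (kermx A))^t*) 0.
  by rewrite -(trmxCK (nz_row _)) e0 trmx0 map_mx0.
by rewrite /sform trmxCK (sub_kermxP (nz_row_sub _)) mul0mx mxE ltxx.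
Qed.

End SesquilinearForm.

(** * Inversion, Cauchy-Schwarz and domination *)

Section Loewner.
Variables (C : numClosedFieldType) (n : nat).
Implicit Types (A B X Y : 'M[C]_n) (x y z : 'cV[C]_n) (a : C).

Lemma loewner_le_refl A : loewner_le A A.
Proof. by move=> x. Qed.

Lemma posdef_le A B : posdef A -> loewner_le A B -> posdef B.
Proof. by move=> pA AB x /pA/lt_le_trans; apply. Qed.

Lemma posdef_invmx_form A x y : posdef A ->
  sform A (invmx A *m x) y = (x^t* *m y) 0 0.
Proof.
move=> pA; rewrite /sform trmx_mul map_mxM trmx_inv map_invmx posdef_herm//.
by rewrite mulmxKV ?posdef_unit.
Qed.

Lemma sform_invmx A x y :
  sform (invmx A) x y = (x^t* *m (invmx A *m y)) 0 0.
Proof. by rewrite /sform mulmxA. Qed.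

Lemma posdef_inv A : posdef A -> posdef (invmx A).
Proof.
move=> pA x xN0; rewrite sform_invmx -(posdef_invmx_form _ _ pA); apply: (pA).
apply: contraNneq xN0 => e0.
by rewrite -(mulKVmx (posdef_unit pA) x) e0 mulmx0.
Qed.

(* Expand [0 <= (X^-1 z - a^-1 Y^-1 z)^* X (X^-1 z - a^-1 Y^-1 z)]. *)
Lemma loewner_le_inv X Y a : 0 < a -> posdef X -> posdef Y ->
  loewner_le X (a *: Y) -> loewner_le (invmx Y) (a *: invmx X).
Proof.
move=> a0 pX pY XY z.
pose u := invmx X *m z; pose v := invmx Y *m z.
have aR : (a^-1)^* = a^-1 by apply/CrealP; rewrite realV gtr0_real.
have := posdef_ge0 (u - a^-1 *: v) pX.
have := XY v.
have qX : sform X u u = sform (invmx X) z z.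
  by rewrite posdef_invmx_form// sform_invmx.
have qY : sform Y v v = sform (invmx Y) z z.
  by rewrite posdef_invmx_form// sform_invmx.
have quv : sform X u v = sform (invmx Y) z z.
  by rewrite posdef_invmx_form// sform_invmx.
have qvu : sform X v u = sform (invmx Y) z z.
  rewrite -sform_real_conj ?quv; last exact: posdef_real.
  exact/CrealP/posdef_real/posdef_inv.
rewrite !(sformDl, sformDr, sformNl, sformNr, sformZl, sformZr, sformZm) aR.
rewrite qX qY quv qvu; set s := sform _ z z; set r := sform _ z z => h1 h2.
have h3 : 0 <= a * (a^-1 * (a^-1 * (a * s - sform X v v))).
  by do 3 (apply: mulr_ge0; first by rewrite ?invr_ge0 ltW); rewrite subr_ge0.
have h := addr_ge0 (mulr_ge0 (ltW a0) h2) h3.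
rewrite -subr_ge0; apply: etrans h; congr (0 <= _); field.
by rewrite gt_eqF.
Qed.

Lemma sform_cauchy_schwarz A x y : posdef A ->
  `|sform A x y| ^+ 2 <= sform A x x * sform A y y.
Proof.
move=> pA; have [->|yN0] := eqVneq y 0.
  by rewrite -(scale0r 0) !sformZr !mul0r normr0 expr0n mulr0.
have q0 := pA _ yN0; set q := sform A y y in q0 *.
(* [t *: y] is the projection of [x] onto [y] with respect to [A]; positivity at [x - t *: y],
   multiplied by [q], is the claim. *)
pose t := sform A y x / q.
have := posdef_ge0 (x - t *: y) pA.
have ts : t^* = sform A x y / q.
  rewrite /t rmorphM /= sform_real_conj; last exact: posdef_real.
  by congr (_ * _); apply/CrealP; rewrite realV gtr0_real.
rewrite !(sformDl, sformDr, sformNl, sformNr, sformZl, sformZr) ts -/q => h.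
rewrite normCK sform_real_conj; last exact: posdef_real.
rewrite -subr_ge0; apply: etrans (mulr_ge0 h (ltW q0)); congr (0 <= _).
rewrite /t; field.
by rewrite gt_eqF.
Qed.

(* Cauchy-Schwarz for the form [A], at [x] and [A^-1 e_i]. *)
Lemma posdef_coord_le A x i : posdef A ->
  `|x i 0| ^+ 2 <= \tr (invmx A) * sform A x x.
Proof.
move=> pA; pose e : 'cV[C]_n := delta_mx i 0.
have -> : x i 0 = sform A (invmx A *m e) x.
  by rewrite posdef_invmx_form// trmx_delta map_delta_mx -rowE mxE.
apply: le_trans (sform_cauchy_schwarz _ _ pA) _.
apply: ler_wpM2r; first exact: posdef_ge0.
rewrite posdef_invmx_form// -sform_invmx// sform_delta /mxtrace (bigD1 i)//=.
rewrite lerDl sumr_ge0// => j _.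
by rewrite -sform_delta posdef_ge0//; exact: posdef_inv.
Qed.

Lemma posdef_trinv_ge0 A : posdef A -> 0 <= \tr (invmx A).
Proof.
move=> pA; apply: sumr_ge0 => j _.
by rewrite -sform_delta posdef_ge0//; exact: posdef_inv.
Qed.

(** Domination without eigenvalues: expand the form of [P] into entries, bound [|x_i| |x_j|] by the
    mean of the two squares, and each square by [posdef_coord_le]. *)
Lemma posdef_dominates P A : posdef P -> posdef A ->
  exists2 a : C, 0 <= a & loewner_le P (a *: A).
Proof.
move=> pP pA; exists (\sum_i \sum_j `|P i j| * \tr (invmx A)).
  apply: sumr_ge0 => i _; apply: sumr_ge0 => j _.
  by rewrite mulr_ge0// posdef_trinv_ge0.
move=> x; rewrite -[leLHS]ger0_norm; last exact: posdef_ge0.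
rewrite sformZm sformE big_distrl /=; apply: le_trans (ler_norm_sum _ _ _) _.
apply: ler_sum => i _; rewrite big_distrl /=.
apply: le_trans (ler_norm_sum _ _ _) _; apply: ler_sum => j _.
rewrite !normrM norm_conjC mulrAC mulrC -mulrA ler_wpM2l//.
have h : `|x i 0| * `|x j 0| <= (`|x i 0| ^+ 2 + `|x j 0| ^+ 2) / 2.
  rewrite ler_pdivlMr// -subr_ge0.
  have h : 0 <= (`|x i 0| - `|x j 0|) ^+ 2 by rewrite real_exprn_even_ge0 ?realB.
  by apply: etrans h; congr (0 <= _); ring.
apply: le_trans h _; rewrite ler_pdivrMr// mulr_natr mulr2n.
by apply: lerD; apply: posdef_coord_le.
Qed.

(** After polarization the four bounds add up to four times the right-hand side, since the cross
    terms of [B] cancel. This turns estimates of quadratic forms into estimates of entries. *)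
Lemma sform_bound A B x y : (forall z, `|sform A z z| <= sform B z z) ->
  `|sform A x y| <= sform B x x + sform B y y.
Proof.
move=> AB; rewrite -(@ler_pMn2r _ 4)// -normrMn sform_polar.
apply: le_trans (ler_normD _ _) _.
apply: le_trans (lerD (ler_normB _ _) (lexx _)) _.
apply: le_trans (lerD (lerD (ler_normB _ _) (lexx _)) (lexx _)) _.
rewrite !normrM normCi !mul1r.
apply: le_trans (lerD (lerD (lerD (AB _) (AB _)) (AB _)) (AB _)) _.
rewrite !(sformDl, sformDr, sformNl, sformNr, sformZl, sformZr) conjCi.
rewrite le_eqVlt; apply/orP; left; apply/eqP; ring: (@sqrCi C).
Qed.

End Loewner.

(** * Mutual domination and the distance between entries *)

Section Contraction.
Variables (C : numClosedFieldType) (n : nat).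
Implicit Types (B X Y Z : 'M[C]_n) (x y z : 'cV[C]_n) (a d : C).

Lemma loewner_le_trans X Y Z : loewner_le X Y -> loewner_le Y Z -> loewner_le X Z.
Proof. by move=> XY YZ x; exact: le_trans (XY x) (YZ x). Qed.

Lemma loewner_leD X Y X' Y' :
  loewner_le X Y -> loewner_le X' Y' -> loewner_le (X + X') (Y + Y').
Proof. by move=> h h' x; rewrite !sformDm lerD. Qed.

(** For positive definite [X], [Y] and [0 <= d]: their Thompson metric is at most log (1 + d). *)
Definition mutually_dominated d X Y :=
  loewner_le X ((1 + d) *: Y) /\ loewner_le Y ((1 + d) *: X).

(** One side gives [X - Y <= d Y], the other [Y - X <= d X <= d (1 + d) Y]. The matrix [B] allows a
    single bound for a whole family of [Y]. *)
Lemma mutually_dominated_entry d X Y B i j : 0 <= d -> posdef Y ->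
  mutually_dominated d X Y -> loewner_le Y B ->
  `|X i j - Y i j| <= d * (1 + d) * (B i i + B j j).
Proof.
move=> d0 pY [XY YX] YB.
have -> : X i j - Y i j = (X - Y) i j by rewrite !mxE.
rewrite -(sform_delta (X - Y)) mulrDr -!(sform_delta B) -!sformZm.
apply: sform_bound => z.
have hXY := XY z; have hYX := YX z; have hYB := YB z.
have q0 := posdef_ge0 z pY.
rewrite !(sformDm, sformNm, sformZm) in hXY hYX hYB *.
set p := sform X z z in hXY hYX hYB *; set q := sform Y z z in q0 hXY hYX hYB *.
have h : d * (1 + d) * q <= d * (1 + d) * sform B z z.
  by rewrite ler_wpM2l// mulr_ge0// addr_ge0.
have h1 : p - q <= d * (1 + d) * q.
  apply: (@le_trans _ _ (d * q)).
    by rewrite lerBlDr; apply: etrans hXY; congr (_ <= _); ring.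
  rewrite -mulrA ler_wpM2l// mulrDl mul1r lerDl mulr_ge0//.
have h2 : q - p <= d * (1 + d) * q.
  apply: (@le_trans _ _ (d * p)); last by rewrite -mulrA ler_wpM2l.
  by rewrite lerBlDr; apply: etrans hYX; congr (_ <= _); ring.
(* Comparability with a real number makes [p - q] real, which the two-sided bound on its norm
   demands. *)
have r : p - q \is Num.real.
  rewrite -(subrK (d * (1 + d) * q) (p - q)) rpredD//.
    by rewrite realE subr_le0 h1 orbT.
  by rewrite ger0_real// !mulr_ge0// addr_ge0.
by apply: le_trans h; rewrite real_ler_norml// h1 andbT lerNl opprB.
Qed.

(** * Order properties and contraction of [fixmap] *)

Section Map.
Variables (m : nat) (A : 'I_m -> 'M[C]_n) (Q : 'M[C]_n).

Definition inv_sum X := \sum_(i < m) ((A i)^t* *m invmx X *m A i).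

Definition fixmap X := Q + inv_sum X.

(** Congruence by [A i] and summation keep the order that inversion has reversed. *)
Lemma inv_sum_anti X Y a : 0 < a -> posdef X -> posdef Y ->
  loewner_le X (a *: Y) -> loewner_le (inv_sum Y) (a *: inv_sum X).
Proof.
move=> a0 pX pY XY x; rewrite sformZm !sform_summ mulr_sumr.
apply: ler_sum => i _; rewrite !sform_congr -sformZm.
exact: loewner_le_inv.
Qed.

Lemma inv_sum_ge0 X x : posdef X -> 0 <= sform (inv_sum X) x x.
Proof.
move=> pX; rewrite sform_summ sumr_ge0// => i _.
by rewrite sform_congr posdef_ge0//; exact: posdef_inv.
Qed.

Lemma fixmap_ge X : posdef X -> loewner_le Q (fixmap X).
Proof. by move=> pX x; rewrite sformDm lerDl inv_sum_ge0. Qed.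

Hypothesis pQ : posdef Q.

Lemma inv_sum_dominated : exists2 c, 0 <= c & loewner_le (inv_sum Q) (c *: Q).
Proof.
(* [inv_sum Q] may be singular, so [posdef_dominates] is applied to [Q + inv_sum Q]. *)
have pQS : posdef (fixmap Q) by exact: posdef_le (fixmap_ge _).
have [c c0 cP] := posdef_dominates pQS pQ.
exists c => //; apply: loewner_le_trans cP => x.
by rewrite sformDm lerDr posdef_ge0.
Qed.

Variable c : C.
Hypotheses (c0 : 0 <= c) (cP : loewner_le (inv_sum Q) (c *: Q)).

Let rate := c / (1 + c).

Let c1 : 0 < 1 + c. Proof. by rewrite ltr_pwDl. Qed.

Lemma rate_ge0 : 0 <= rate. Proof. by rewrite divr_ge0// ltW. Qed.

Lemma rate_lt1 : rate < 1. Proof. by rewrite ltr_pdivrMr// mul1r ltrDr. Qed.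

Lemma inv_sum_le X : loewner_le Q X -> loewner_le (inv_sum X) (c *: Q).
Proof.
move=> QX; apply: loewner_le_trans cP; rewrite -[inv_sum Q]scale1r.
by apply: inv_sum_anti; rewrite ?scale1r//; exact: posdef_le QX.
Qed.

Lemma fixmap_le X : loewner_le Q X -> loewner_le (fixmap X) ((1 + c) *: Q).
Proof.
move=> QX; rewrite scalerDl scale1r; apply: loewner_leD => //.
exact: inv_sum_le.
Qed.

(* [Q + (1 + d) S <= (1 + d') (Q + S)] amounts to [(d - d') S <= d' Q], and
   [d' = rate * d] is chosen so that [S <= c Q] is enough. *)
Lemma fixmap_contract_le d X Y : 0 <= d -> loewner_le Q X -> loewner_le Q Y ->
  loewner_le Y ((1 + d) *: X) ->
  loewner_le (fixmap X) ((1 + rate * d) *: fixmap Y).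
Proof.
move=> d0 QX QY YX z.
have d1 : 0 < 1 + d by rewrite ltr_pwDl.
have h := inv_sum_anti d1 (posdef_le pQ QY) (posdef_le pQ QX) YX z.
have h' := inv_sum_le QY z.
rewrite !(sformDm, sformZm) in h h' *.
set s := sform (inv_sum Y) z z in h h' *; set q := sform Q z z in h' *.
apply: le_trans (lerD (lexx q) h) _.
rewrite -subr_ge0.
have -> : (1 + rate * d) * (q + s) - (q + (1 + d) * s) = d / (1 + c) * (c * q - s).
  by rewrite /rate; field; rewrite gt_eqF.
by rewrite mulr_ge0 ?subr_ge0// divr_ge0// ltW.
Qed.

Lemma fixmap_contract d X Y : 0 <= d -> loewner_le Q X -> loewner_le Q Y ->
  mutually_dominated d X Y ->
  mutually_dominated (rate * d) (fixmap X) (fixmap Y).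
Proof. by move=> d0 QX QY [XY YX]; split; exact: fixmap_contract_le. Qed.

Lemma iter_fixmap_ge k X : loewner_le Q X -> loewner_le Q (iter k fixmap X).
Proof.
by move=> QX; elim: k => //= k IH; apply: fixmap_ge; exact: posdef_le IH.
Qed.

Lemma iter_fixmap_contract d X Y k : 0 <= d -> loewner_le Q X ->
  loewner_le Q Y -> mutually_dominated d X Y ->
  mutually_dominated (rate ^+ k * d) (iter k fixmap X) (iter k fixmap Y).
Proof.
move=> d0 QX QY XY; elim: k => [|k IH] /=; first by rewrite mul1r.
rewrite exprS -mulrA; apply: fixmap_contract => //; try exact: iter_fixmap_ge.
by rewrite mulr_ge0// exprn_ge0// rate_ge0.
Qed.

(** All iterates lie between [Q] and [(1 + c) *: Q], so the constant is uniform in [k]; this starts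
    the Cauchy estimate. *)
Lemma mutually_dominated_iter k :
  mutually_dominated c Q (iter k fixmap Q).
Proof.
split.
  apply: loewner_le_trans (iter_fixmap_ge k (@loewner_le_refl _ _ Q)) _ => x.
  rewrite sformZm mulrDl mul1r lerDl mulr_ge0// posdef_ge0//.
  exact/(posdef_le pQ)/iter_fixmap_ge.
case: k => [|k] /=; last exact/fixmap_le/iter_fixmap_ge.
by move=> x; rewrite sformZm mulrDl mul1r lerDl mulr_ge0// posdef_ge0.
Qed.

End Map.
End Contraction.

(** * Entrywise limits of matrices *)

Section EntrywiseLimits.
Variables (C : numClosedFieldType) (n : nat).
Implicit Types (X Y : 'M[C]_n) (Xs Ys : nat -> 'M[C]_n).

(** Limits are taken entry by entry so that scalar limit theorems apply; [entrywise_cvgE] passes to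
    the matrix topology. *)
Definition entrywise_cvg Xs X := forall i j, Xs k i j @[k --> \oo] --> X i j.

Lemma entrywise_cvgE Xs X : entrywise_cvg Xs X -> Xs k @[k --> \oo] --> X.
Proof.
move=> XX; apply/cvg_ballP => e e0.
have h i : \forall k \near \oo, forall j, ball (X i j) e (Xs k i j).
  by apply: filter_forall => j; exact: (cvg_ball (XX i j)).
have {}h : \forall k \near \oo, forall i j, ball (X i j) e (Xs k i j).
  exact: filter_forall.
near=> k; split => //; near: k.
exact: h.
Unshelve. all: by end_near. Qed.

Lemma entrywise_cvg_unique Xs X Y :
  entrywise_cvg Xs X -> entrywise_cvg Xs Y -> X = Y.
Proof.
move=> XX XY; apply/matrixP => i j.
by apply: (cvg_unique _ (XX i j) (XY i j)); exact: norm_hausdorff.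
Qed.

Lemma cvg_sumr (I : finType) (u : I -> nat -> C) (l : I -> C) :
  (forall i, u i k @[k --> \oo] --> l i) ->
  \sum_i u i k @[k --> \oo] --> \sum_i l i.
Proof.
move=> ul; elim: (index_enum I) => [|i r IH].
  by rewrite big_nil; under eq_fun do rewrite big_nil; exact: cvg_cst.
rewrite big_cons; under eq_fun do rewrite big_cons.
by apply: cvgD; [exact: ul|exact: IH].
Qed.

Lemma sform_cvg Xs X x y : entrywise_cvg Xs X ->
  sform (Xs k) x y @[k --> \oo] --> sform X x y.
Proof.
move=> XX; rewrite sformE; under eq_fun do rewrite sformE.
apply: cvg_sumr => i; apply: cvg_sumr => j.
by apply: cvgM; [apply: cvgM => //|]; exact: cvg_cst.
Qed.

(* Limits preserve [0 <=] because it means [`|z| = z]. *)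
Lemma cvg_le (u v : nat -> C) a b : u k @[k --> \oo] --> a ->
  v k @[k --> \oo] --> b -> (forall k, u k <= v k) -> a <= b.
Proof.
move=> ua vb uv; rewrite -subr_ge0.
have h : v k - u k @[k --> \oo] --> b - a by exact: cvgB.
have h' : v k - u k @[k --> \oo] --> `|b - a|.
  under eq_fun do rewrite -[_ - _]ger0_norm ?subr_ge0//.
  exact: cvg_norm.
by rewrite (cvg_unique _ h h') //; exact: norm_hausdorff.
Qed.

Lemma loewner_le_cvg Xs Ys X Y : entrywise_cvg Xs X -> entrywise_cvg Ys Y ->
  (forall k, loewner_le (Xs k) (Ys k)) -> loewner_le X Y.
Proof.
move=> XX YY XY x.
by apply: (cvg_le (@sform_cvg _ _ x x XX) (@sform_cvg _ _ x x YY)) => k; exact: XY.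
Qed.

Lemma entrywise_cvg_cst X : entrywise_cvg (fun=> X) X.
Proof. by move=> i j; exact: cvg_cst. Qed.

Lemma entrywise_cvgZ a Xs X : entrywise_cvg Xs X ->
  entrywise_cvg (fun k => a *: Xs k) (a *: X).
Proof.
move=> XX i j; rewrite mxE; under eq_fun do rewrite mxE.
by apply: cvgM => //; exact: cvg_cst.
Qed.

Lemma entrywise_cvg_shift k Xs X : entrywise_cvg Xs X ->
  entrywise_cvg (fun l => Xs (l + k)%N) X.
Proof.
move=> XX i j.
by rewrite (@cvg_shiftn _ _ (fun l => Xs l i j)).
Qed.

Lemma entrywise_cvg_unshift k Xs X :
  entrywise_cvg (fun l => Xs (l + k)%N) X -> entrywise_cvg Xs X.
Proof.
move=> XX i j; have := XX i j.
by rewrite (@cvg_shiftn _ _ (fun l => Xs l i j)).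
Qed.

(** The sequence has the shape of the bound in [mutually_dominated_entry]. *)
Lemma cvg_quadratic0 (d : nat -> C) b : d k @[k --> \oo] --> (0 : C) ->
  d k * (1 + d k) * b @[k --> \oo] --> (0 : C).
Proof.
move=> d0; rewrite -(mul0r b) -[in X in X * _](mul0r (1 + 0)).
apply: cvgM; last exact: cvg_cst.
by apply: cvgM => //; apply: cvgD => //; exact: cvg_cst.
Qed.

Lemma mutually_dominated_cvg d X Ys Y : entrywise_cvg Ys Y ->
  (forall k, mutually_dominated d X (Ys k)) -> mutually_dominated d X Y.
Proof.
move=> YY XY; split.
  have YYd := @entrywise_cvgZ (1 + d) _ _ YY.
  apply: (loewner_le_cvg (@entrywise_cvg_cst X) YYd) => k.
  by case: (XY k).
apply: (loewner_le_cvg YY (@entrywise_cvg_cst ((1 + d) *: X))) => k.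
by case: (XY k).
Qed.

Lemma cvg_mutually_dominated (d : nat -> C) Xs Y : (forall k, 0 <= d k) ->
  d k @[k --> \oo] --> 0 -> posdef Y ->
  (forall k, mutually_dominated (d k) (Xs k) Y) -> entrywise_cvg Xs Y.
Proof.
move=> d0 dcvg pY XY i j; apply/cvgrPdist_le => e e0.
move/cvgrPdist_le : (@cvg_quadratic0 _ (Y i i + Y j j) dcvg) => /(_ e e0).
apply: filterS => k.
(* The limit [Y] itself serves as the upper bound [B]. *)
have hk := mutually_dominated_entry i j (d0 k) pY (XY k) (loewner_le_refl Y).
rewrite sub0r normrN distrC; apply: le_trans.
by rewrite [leRHS]ger0_norm// (le_trans _ hk).
Qed.

End EntrywiseLimits.

(** * Geometric and Cauchy sequences of complex numbers *)

Section Complexes.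
Variable R : realType.
Local Open Scope complex_scope.

Lemma normc_real (t : R) : `|t%:C| = `|t|%:C :> R[i].
Proof. by rewrite normc_def /= expr0n addr0 sqrtr_sqr. Qed.

Lemma cvg_complexes (x y : nat -> R) (a b : R) : x k @[k --> \oo] --> a ->
  y k @[k --> \oo] --> b ->
  ((x k +i* y k : complexes R) @[k --> \oo] --> (a +i* b : complexes R)).
Proof.
move=> xa yb; apply/cvgrPdist_le => e e0.
(* The radius [e] is a positive element of [complexes R], hence the image of a real [r]. *)
have /complex_realP[r rE] := gtr0_real e0.
have r0 : 0 < r / 2 by move: e0; rewrite rE ltcR => ?; rewrite divr_gt0.
move/cvgrPdist_le : xa => /(_ _ r0) xa; move/cvgrPdist_le : yb => /(_ _ r0) yb.
near=> k.
have -> : (a +i* b : complexes R) - (x k +i* y k : complexes R)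
    = (a - x k)%:C + 'i%C * (b - y k)%:C by simpc.
apply: le_trans (ler_normD _ _) _; rewrite normrM.
have -> : `|'i%C| = 1 :> R[i] by rewrite normc_def /= expr0n expr1n add0r sqrtr1.
rewrite mul1r !normc_real rE -rmorphD lecR (splitr r); apply: lerD; near: k.
  exact: xa.
exact: yb.
Unshelve. all: by end_near. Qed.

(** [0 <= z] makes [z] real, so the real geometric limit applies. *)
Lemma cvg_expr_complexes (z : complexes R) : 0 <= z -> z < 1 ->
  z ^+ k @[k --> \oo] --> (0 : complexes R).
Proof.
move=> z0 z1.
have /complex_realP[r rE] := ger0_real z0.
move: z0 z1; rewrite rE ler0c (ltcR r 1) => r0 r1.
have := cvg_complexes (@cvg_expr _ r _) (@cvg_cst _ (0 : R) _ _ _).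
rewrite ger0_norm// => /(_ r1 _).
under eq_fun do rewrite complexr0 rmorphXn.
by apply.
Qed.

(** Real and imaginary parts are bounded by the norm, so both are Cauchy in the complete field
    [R]. *)
Lemma cauchy_cvg_complexes (u e : nat -> complexes R) :
  e k @[k --> \oo] --> (0 : complexes R) ->
  (forall k l, `|u k - u (k + l)%N| <= e k) ->
  exists w : complexes R, u k @[k --> \oo] --> w.
Proof.
move=> e0 ue.
have real_cvg (x : nat -> R) :
    (forall k l, `|(x k - x (k + l)%N)%:C| <= e k) ->
    exists w : R, x k @[k --> \oo] --> w.
  move=> xe; suff /cvg_ex : cvg (x @ \oo) by [].
  apply/cauchy_cvgP/cauchyP => r r0.
  have rC : (0 : complexes R) < r%:C by rewrite ltcR.
  move/cvgrPdist_lt : e0 => /(_ _ rC) [K _ hK].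
  exists (x K); exists K => // k /= Kk.
  rewrite -ball_normE /= -ltcR.
  rewrite -normc_real -(subnKC Kk); apply: le_lt_trans (xe _ _) _.
  have eK : 0 <= e K by apply: le_trans (xe K 0%N).
  by have := hK K (leqnn K); rewrite /= sub0r normrN ger0_norm.
have [a xa] : exists w : R, complex.Re (u k) @[k --> \oo] --> w.
  apply: real_cvg => k l; apply: le_trans (ue k l).
  rewrite normc_real normc_def lecR -sqrtr_sqr ler_wsqrtr//.
  by case: (u k) (u (k + l)%N) => [? ?] [? ?] /=; rewrite lerDl sqr_ge0.
have [b yb] : exists w : R, complex.Im (u k) @[k --> \oo] --> w.
  apply: real_cvg => k l; apply: le_trans (ue k l).
  rewrite normc_real normc_def lecR -sqrtr_sqr ler_wsqrtr//.
  by case: (u k) (u (k + l)%N) => [? ?] [? ?] /=; rewrite lerDr sqr_ge0.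
exists (a +i* b).
have uE : u = fun k => complex.Re (u k) +i* complex.Im (u k).
  by apply/funext => k; case: (u k).
by rewrite uE; exact: cvg_complexes.
Qed.
End Complexes.

(** * The attracting fixed point *)

Section FixedPoint.
Variables (C : numClosedFieldType) (n m : nat).
(** Vanishing of geometric sequences and completeness are what a [numClosedFieldType] can lack;
    [cvg_expr_complexes] and [cauchy_cvg_complexes] supply them for the complex numbers. *)
Hypothesis expr_cvg : forall z : C, 0 <= z -> z < 1 ->
  z ^+ k @[k --> \oo] --> (0 : C).
Hypothesis cauchy_rate_cvg : forall u e : nat -> C, e k @[k --> \oo] --> (0 : C) ->
  (forall k l, `|u k - u (k + l)%N| <= e k) ->
  exists w : C, u k @[k --> \oo] --> w.
Variables (A : 'I_m -> 'M[C]_n) (Q : 'M[C]_n).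
Hypothesis pQ : posdef Q.

Local Notation F := (fixmap A Q).

Lemma fixmap_attracting_fixpoint : exists X : 'M[C]_n,
  [/\ posdef X, F X = X &
      forall Y, posdef Y -> entrywise_cvg (fun k => iter k F Y) X].
Proof.
have [c c0 cP] := inv_sum_dominated A pQ.
pose r := c / (1 + c).
have r0 : 0 <= r := rate_ge0 c0.
have rk0 d k : 0 <= d -> 0 <= r ^+ k * d.
  by move=> d0; rewrite mulr_ge0// exprn_ge0.
have r_cvg (d : C) : r ^+ k * d @[k --> \oo] --> (0 : C).
  rewrite -[in X in _ --> X](mul0r d); apply: cvgM; last exact: cvg_cst.
  by apply: expr_cvg => //; exact: rate_lt1.
pose x k := iter k F Q.
have Qx k : loewner_le Q (x k).
  exact/(iter_fixmap_ge _ pQ)/loewner_le_refl.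
(* [x (l + k)] is the [k]-th iterate from [x l], so [k] contraction steps act on the pair [Q],
   [x l], whose distance is bounded uniformly in [l]. *)
have x_dom k l : mutually_dominated (r ^+ k * c) (x k) (x (l + k)%N).
  rewrite addnC /x iterD.
  apply: (iter_fixmap_contract pQ c0 cP k c0 (@loewner_le_refl _ _ Q) (Qx l)).
  exact: (mutually_dominated_iter pQ c0 cP).
have x_le k : loewner_le (x k) ((1 + c) *: Q).
  by have [_] := x_dom 0%N k; rewrite mul1r addn0.
have x_entry i j : exists w : C, x k i j @[k --> \oo] --> w.
  (* [(1 + c) *: Q] bounds every iterate and serves as [B], so the rate is independent of [l]. *)
  pose q := ((1 + c) *: Q) i i + ((1 + c) *: Q) j j; pose d k := r ^+ k * c.
  apply: (@cauchy_rate_cvg _ (fun k => d k * (1 + d k) * q)).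
    exact: (@cvg_quadratic0 C d q (r_cvg c)).
  move=> k l; rewrite addnC.
  apply: (mutually_dominated_entry i j (rk0 _ k c0) _ (x_dom k l) (x_le _)).
  exact: posdef_le (Qx _).
have [X xX] : exists X : 'M[C]_n, entrywise_cvg x X.
  have [w hw] := choice (fun ij : 'I_n * 'I_n => x_entry ij.1 ij.2).
  by exists (\matrix_(i, j) w (i, j)) => i j; rewrite mxE; exact: (hw (i, j)).
have QX : loewner_le Q X.
  exact: (loewner_le_cvg (@entrywise_cvg_cst _ _ Q) xX).
have pX : posdef X := posdef_le pQ QX.
(* Let [l] tend to infinity in [x_dom]. *)
have x_domX k : mutually_dominated (r ^+ k * c) (x k) X.
  exact: (mutually_dominated_cvg (entrywise_cvg_shift k xX)).
(* [x (k + 1) = F (x k)] tends to [X], and by contraction also to [F X]; this replaces continuity of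
   inversion. *)
have FX : F X = X.
  apply: (@entrywise_cvg_unique _ _ (fun k => x (k + 1)%N)); last first.
    exact: entrywise_cvg_shift.
  apply: (@cvg_mutually_dominated _ _ (fun k => r ^+ k * (r * c))) => //.
  - by move=> k; apply: rk0; exact: mulr_ge0.
  - exact: posdef_le pQ (fixmap_ge A Q pX).
  - move=> k; rewrite mulrCA addn1.
    exact: (fixmap_contract pQ c0 cP (rk0 c k c0) (Qx k) QX (x_domX k)).
exists X; split => // Y pY.
(* [Y] need not lie above [Q] but [F Y] does, so the contraction starts there and the index is
   shifted back by one at the end. *)
have QFY : loewner_le Q (F Y) := fixmap_ge A Q pY.
have pFY : posdef (F Y) := posdef_le pQ QFY.
have [a a0 FYX] := posdef_dominates pFY pX.
have [b b0 XFY] := posdef_dominates pX pFY.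
have d0 : 0 <= a + b by exact: addr_ge0.
have iterX k : iter k F X = X by exact: iter_fix.
(* [1 + (a + b)] exceeds both domination constants. *)
have dom : mutually_dominated (a + b) (F Y) X.
  split=> z; [apply: le_trans (FYX z) _|apply: le_trans (XFY z) _];
    rewrite !sformZm; apply: ler_wpM2r; rewrite ?posdef_ge0//.
    by rewrite addrCA lerDl addr_ge0.
  by rewrite addrA lerDr addr_ge0.
apply: (@entrywise_cvg_unshift _ _ 1).
apply: (@cvg_mutually_dominated _ _ (fun k => r ^+ k * (a + b))) => //.
  by move=> k; exact: rk0.
move=> k; rewrite addn1 iterSr -[X in mutually_dominated _ _ X](iterX k).
exact: (iter_fixmap_contract pQ c0 cP k d0 QFY QX dom).
Qed.
End FixedPoint.

(** * The matrix equation over the complex numbers *)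

Theorem theorem3p2 (R : realType) (m n : nat) (hm : (1 <= m)%N) (hn : (1 <= n)%N)
    (A : 'I_m -> 'M[complexes R]_n) (Q : 'M[complexes R]_n)
    (hQ : hermitian_posdef Q) :
  exists X : 'M[complexes R]_n,
    unique (fun Y : 'M[complexes R]_n =>
              hermitian_posdef Y /\
              Y - \sum_(i < m) ((A i)^t* *m invmx Y *m A i) = Q) X /\
    (forall X_ : nat -> 'M[complexes R]_n,
        hermitian_posdef (X_ 0%N) ->
        (forall k : nat,
            X_ k.+1 = Q + \sum_(i < m) ((A i)^t* *m invmx (X_ k) *m A i)) ->
        X_ k @[k --> \oo] --> X).
Proof.
have pQ := (hermitian_posdefE Q).1 hQ.
have [X [pX FX FcvgX]] := fixmap_attracting_fixpoint
  (@cvg_expr_complexes R) (@cauchy_cvg_complexes R) A pQ.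
exists X; split.
  split.
    split; first exact/hermitian_posdefE.
    by rewrite -{1}FX addrK.
  move=> Y [/hermitian_posdefE pY YQ].
  (* The orbit of another solution [Y] is constant and converges to [X], hence [Y = X]. *)
  have FY : fixmap A Q Y = Y by rewrite /fixmap -YQ subrK.
  have iterY k : iter k (fixmap A Q) Y = Y by exact: iter_fix.
  apply: (entrywise_cvg_unique (FcvgX Y pY)).
  by under eq_fun do rewrite iterY; exact: entrywise_cvg_cst.
move=> X_ /hermitian_posdefE pX0 X_S; apply: entrywise_cvgE.
have -> : X_ = fun k => iter k (fixmap A Q) (X_ 0%N).
  by apply/funext; elim=> [|k IH]; [|rewrite iterS -IH X_S].
exact: FcvgX.
Qed.
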